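(* Let $M,N\ge1$ be integers, $P,\sigma^2,\beta_1,\beta_2,\alpha_{\rm A\text{-}RIS}>0$, and let $\mathbf{a}_1,\mathbf{a}_{2,2}\in\mathbb{C}^N$ have unit-modulus entries. For complex numbers $\psi_1,\dots,\psi_N$ with $|\psi_n|\le\alpha_{\rm A\text{-}RIS}$ and $\mathbf{\Psi}=\mathrm{diag}(\psi_1,\dots,\psi_N)$, define the active-RIS SNR $$\mathrm{SNR}(\mathbf{\Psi})=\frac{P\beta_1\beta_2M\left|\mathbf{a}_{2,2}^{T}\mathbf{\Psi}\mathbf{a}_1\right|^2}{\sigma^2\left(1+\beta_2M\sum_{n=1}^N|\psi_n|^2\right)}.$$ Then $\mathrm{SNR}(\mathbf{\Psi})$ is maximized, subject to $|\psi_n|\le\alpha_{\rm A\text{-}RIS}$ for all $n$, by $$\psi_n=\alpha_{\rm A\text{-}RIS}\exp\left(\mathsf{j}\left(-\angle[\mathbf{a}_1]_n-\angle[\mathbf{a}_{2,2}]_n\right)\right),\quad n=1,\dots,N,$$ and the maximum value is $$\mathrm{SNR}_{\rm A\text{-}RIS}=\frac{\alpha_{\rm A\text{-}RIS}^2P\beta_1\beta_2N^2M}{\sigma^2\left(1+\alpha_{\rm A\text{-}RIS}^2\beta_2MN\right)}.$$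
   Context: $\mathsf{j}$ is the imaginary unit, $\angle z$ is the argument of $z\in\mathbb{C}$, $[\mathbf{a}]_n$ is the $n$-th entry of $\mathbf{a}$, and $(\cdot)^T$ is the transpose. $\mathrm{SNR}(\mathbf{\Psi})$ is the uplink SNR with an active RIS (each element multiplies its noisy received signal by $\psi_n$, with noise variance $\sigma^2$ at each RIS element and each of the $M$ base station antennas), under optimal receive combining and no direct user–base-station link. *)

(* Defs.v *)
From HB Require Import structures.
From mathcomp Require Import all_boot all_order all_algebra.
From mathcomp Require Import complex.
From mathcomp Require Import reals sequences exp trigo.

Set Implicit Arguments.
Unset Strict Implicit.
Unset Printing Implicit Defensive.

Import Order.TTheory GRing.Theory Num.Theory.
Import ComplexField.Normc.

Local Open Scope ring_scope.
Local Open Scope complex_scope.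

(* Principal argument, with values in ]-pi, pi] and the convention arg 0 = 0. *)
Definition carg (R : realType) (z : R[i]) : R :=
  if z == 0 then 0
  else if 0 <= complex.Im z then acos (complex.Re z / normc z)
  else - acos (complex.Re z / normc z).

Definition cexp (R : realType) (z : R[i]) : R[i] :=
  (expR (complex.Re z))%:C * (cos (complex.Im z) +i* sin (complex.Im z)).

(* The diagonal matrix Psi is represented by the row vector psi of its
   diagonal entries. *)
Definition activeRIS_SNR (R : realType) (M N : nat)
    (P sigma2 beta1 beta2 : R) (a1 a22 : 'cV[R[i]]_N) (psi : 'rV[R[i]]_N) : R :=
  (P * beta1 * beta2 * M%:R * normc ((a22^T *m diag_mx psi *m a1) 0 0) ^+ 2)
  / (sigma2 * (1 + beta2 * M%:R * \sum_(n < N) normc (psi 0 n) ^+ 2)).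

Definition RIS_feasible (R : realType) (N : nat) (alpha : R)
    (psi : 'rV[R[i]]_N) : Prop :=
  forall n : 'I_N, normc (psi 0 n) <= alpha.

Definition RIS_phase_aligned (R : realType) (N : nat) (alpha : R)
    (a1 a22 : 'cV[R[i]]_N) : 'rV[R[i]]_N :=
  \row_(n < N) (alpha%:C * cexp ('i * (- carg (a1 n 0) - carg (a22 n 0))%:C)).

(* Main.v *)
(** By the triangle inequality and Cauchy-Schwarz, the gain satisfies
    |a22^T Psi a1|^2 <= N * S with S := sum_n |psi_n|^2, and S <= N * alpha^2.
    The SNR is thus at most the value at S = N * alpha^2 of an increasing
    function of the form S |-> c * S / (1 + b * S).  Aligning the phases makes
    every summand of the gain equal to alpha, so both bounds are attained. *)

Require Import Defs.
From mathcomp Require Import all_boot all_order all_algebra.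
From mathcomp Require Import complex.
From mathcomp Require Import reals.
From mathcomp Require Import sequences exp trigo ring lra.

Import Order.TTheory GRing.Theory Num.Theory.
Import ComplexField.Normc.

Local Open Scope ring_scope.
Local Open Scope complex_scope.

Lemma cexp_imE (R : realType) (t : R) :
  cexp ('i * t%:C) = cos t +i* sin t.
Proof.
rewrite /cexp; simpc.
by rewrite /= ?mul0r ?mul1r ?subr0 ?addr0 ?oppr0 expR0 !mul1r.
Qed.

Lemma cexp_imD (R : realType) (s t : R) :
  cexp ('i * (s + t)%:C) = cexp ('i * s%:C) * cexp ('i * t%:C).
Proof. by rewrite !cexp_imE cosD sinD; simpc; rewrite [X in _ +i* X]addrC. Qed.

Lemma cexp_im0 (R : realType) : cexp ('i * (0 : R)%:C) = 1.
Proof. by rewrite cexp_imE cos0 sin0. Qed.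

Lemma normc_cexp_im (R : realType) (t : R) : normc (cexp ('i * t%:C)) = 1.
Proof. by rewrite cexp_imE /= cos2Dsin2 sqrtr1. Qed.

(** With [z = x +i* y] on the unit circle, [acos x] has cosine [x] and sine [|y|]. The sign chosen
    in [carg] according to the sign of [y] turns [|y|] back into [y]. *)
Lemma cexp_im_carg (R : realType) (z : R[i]) :
  normc z = 1 -> cexp ('i * (carg z)%:C) = z.
Proof.
case: z => x y /= xy1; rewrite cexp_imE.
have xy : x ^+ 2 + y ^+ 2 = 1.
  by rewrite -[LHS]sqr_sqrtr ?addr_ge0 ?sqr_ge0// xy1 expr1n.
have x1 : -1 <= x <= 1 by apply/andP; split; have := sqr_ge0 y; nra.
rewrite /carg /= xy1 divr1.
(* The convention for the argument of [0] never applies on the unit circle. *)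
have -> : (x +i* y == 0) = false.
  apply/negbTE/eqP => -[x0 y0]; move: xy.
  by rewrite x0 y0 expr0n addr0 => /eqP; rewrite eq_sym oner_eq0.
have sinx : sin (acos x) = `|y|.
  by rewrite sin_acos// -xy addrAC subrr add0r sqrtr_sqr.
case: ifPn => [y0|]; first by rewrite sinx acosK ?in_itv//= ger0_norm.
rewrite -ltNge => y0.
by rewrite cosN sinN sinx acosK ?in_itv//= ltr0_norm// opprK.
Qed.

Lemma normc_ge0 (R : rcfType) (z : R[i]) : 0 <= normc z.
Proof. by case: z => x y; rewrite sqrtr_ge0. Qed.

Lemma normc_real (R : rcfType) (x : R) : 0 <= x -> normc x%:C = x.
Proof. by move=> x0; rewrite /= expr0n addr0 sqrtr_sqr ger0_norm. Qed.

Lemma le_normc_sum (R : rcfType) (I : Type) (r : seq I) (F : I -> R[i]) :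
  normc (\sum_(i <- r) F i) <= \sum_(i <- r) normc (F i).
Proof.
elim: r => [|i r IHr]; first by rewrite !big_nil normc0.
by rewrite !big_cons (le_trans (le_normcD _ _))// lerD2l.
Qed.

(** Cauchy-Schwarz against the all-ones vector. Both sides are double sums over [i] and [j], and
    [F i * F j <= (F i ^+ 2 + F j ^+ 2) / 2] compares them term by term. *)
Lemma sqr_sum_le (R : realFieldType) (n : nat) (F : 'I_n -> R) :
  (\sum_i F i) ^+ 2 <= n%:R * \sum_i F i ^+ 2.
Proof.
have sumC (c : R) : \sum_(i < n) c = n%:R * c.
  by rewrite sumr_const card_ord mulr_natl.
have -> : n%:R * \sum_i F i ^+ 2 = \sum_i \sum_j (F i ^+ 2 + F j ^+ 2) / 2.
  under [RHS]eq_bigr => i _ do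
    rewrite -mulr_suml big_split/= sumC.
  by rewrite -mulr_suml big_split/= sumC -mulr_sumr; field.
rewrite expr2 mulr_suml; apply: ler_sum => i _.
rewrite mulr_sumr; apply: ler_sum => j _.
have := sqr_ge0 (F i - F j); nra.
Qed.

(** Once the positive denominators are cleared, the term [b * x * y] occurs on both sides and only
    [x <= y] remains. *)
Lemma ler_div1D (R : realFieldType) (b x y : R) :
  0 <= b -> 0 <= x -> x <= y -> x / (1 + b * x) <= y / (1 + b * y).
Proof.
move=> b0 x0 xy; have y0 := le_trans x0 xy.
rewrite ler_pdivrMr ?ltr_pwDl ?mulr_ge0// mulrAC.
rewrite ler_pdivlMr ?ltr_pwDl ?mulr_ge0//; nra.
Qed.

Lemma diag_bilinearE (R : comPzRingType) (n : nat) (u v : 'cV[R]_n)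
    (d : 'rV[R]_n) :
  (u^T *m diag_mx d *m v) 0 0 = \sum_i u i 0 * d 0 i * v i 0.
Proof.
by rewrite mxE; apply: eq_bigr => i _; rewrite mul_mx_diag !mxE.
Qed.

Lemma sqr_normc_gain_le (R : rcfType) (n : nat) (u v : 'cV[R[i]]_n)
    (d : 'rV[R[i]]_n) :
  (forall i, normc (u i 0) = 1) -> (forall i, normc (v i 0) = 1) ->
  normc ((u^T *m diag_mx d *m v) 0 0) ^+ 2
    <= n%:R * \sum_i normc (d 0 i) ^+ 2.
Proof.
move=> u1 v1; apply: le_trans (sqr_sum_le _ _ _); rewrite diag_bilinearE.
rewrite ler_sqr ?nnegrE ?normc_ge0 ?sumr_ge0// => [|i _]; last exact: normc_ge0.
apply: le_trans (le_normc_sum _ _ _ _) _.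
by apply: ler_sum => i _; rewrite !normcM u1 v1 mul1r mulr1.
Qed.

Lemma normc_phase_aligned (R : realType) (n : nat) (alpha : R)
    (a1 a22 : 'cV[R[i]]_n) (i : 'I_n) :
  0 <= alpha -> normc (RIS_phase_aligned alpha a1 a22 0 i) = alpha.
Proof. by move=> alpha_ge0; rewrite mxE normcM normc_cexp_im mulr1 normc_real. Qed.

Lemma gain_phase_aligned (R : realType) (n : nat) (alpha : R)
    (a1 a22 : 'cV[R[i]]_n) :
  (forall i, normc (a1 i 0) = 1) -> (forall i, normc (a22 i 0) = 1) ->
  (a22^T *m diag_mx (RIS_phase_aligned alpha a1 a22) *m a1) 0 0
    = (n%:R * alpha)%:C.
Proof.
move=> a1_1 a22_1; rewrite diag_bilinearE.
rewrite (eq_bigr (fun=> alpha%:C)) => [|i _].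
  by rewrite sumr_const card_ord mulr_natl rmorphMn.
rewrite mxE; set e := cexp _.
(* Having unit modulus, both entries equal the exponentials of their arguments, and [e] carries
   exactly the opposite total phase. *)
suff eK : e * (a1 i 0 * a22 i 0) = 1.
  by rewrite -[RHS]mulr1 -eK; ring.
rewrite -{1}(cexp_im_carg _ _ (a1_1 i)) -{1}(cexp_im_carg _ _ (a22_1 i)).
by rewrite -!cexp_imD -opprD addNr cexp_im0.
Qed.

Theorem mainTheorem3 (R : realType) (M N : nat)
    (P sigma2 beta1 beta2 alpha : R) (a1 a22 : 'cV[R[i]]_N)
    (M_ge1 : (1 <= M)%N) (N_ge1 : (1 <= N)%N)
    (P_gt0 : 0 < P) (sigma2_gt0 : 0 < sigma2)
    (beta1_gt0 : 0 < beta1) (beta2_gt0 : 0 < beta2) (alpha_gt0 : 0 < alpha)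
    (a1_unimod : forall n : 'I_N, normc (a1 n 0) = 1)
    (a22_unimod : forall n : 'I_N, normc (a22 n 0) = 1) :
  let SNR := activeRIS_SNR M P sigma2 beta1 beta2 a1 a22 in
  let psi_opt := RIS_phase_aligned alpha a1 a22 in
  [/\ RIS_feasible alpha psi_opt,
      forall psi : 'rV[R[i]]_N, RIS_feasible alpha psi -> SNR psi <= SNR psi_opt
    & SNR psi_opt =
      (alpha ^+ 2 * P * beta1 * beta2 * N%:R ^+ 2 * M%:R)
      / (sigma2 * (1 + alpha ^+ 2 * beta2 * M%:R * N%:R))].
Proof.
move=> SNR psi_opt; have alpha_ge0 := ltW alpha_gt0.
have SNR_opt : SNR psi_opt =
    (alpha ^+ 2 * P * beta1 * beta2 * N%:R ^+ 2 * M%:R)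
    / (sigma2 * (1 + alpha ^+ 2 * beta2 * M%:R * N%:R)).
  rewrite /SNR /activeRIS_SNR gain_phase_aligned//.
  rewrite normc_real ?mulr_ge0 ?ler0n//.
  under eq_bigr do rewrite normc_phase_aligned//.
  rewrite sumr_const card_ord -mulr_natl.
  by congr (_ / _); ring.
split=> //; first by move=> n; rewrite normc_phase_aligned.
move=> psi psi_le; rewrite SNR_opt /SNR /activeRIS_SNR.
set S := \sum_n _; set b := beta2 * M%:R.
have b_ge0 : 0 <= b by rewrite mulr_ge0 ?ler0n// ltW.
have S_ge0 : 0 <= S by apply: sumr_ge0 => n _; apply: sqr_ge0.
have S_le : S <= N%:R * alpha ^+ 2.
  rewrite mulr_natl -[N in _ *+ N]card_ord -sumr_const.
  by apply: ler_sum => n _; rewrite ler_sqr ?nnegrE ?normc_ge0.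
(* Replacing the squared gain by its bound [N%:R * S] turns the SNR into [c * (S / (1 + b * S))],
   where [c] does not depend on [psi]. *)
pose c := P * beta1 * b * N%:R / sigma2.
have c_ge0 : 0 <= c.
  by rewrite divr_ge0 ?mulr_ge0 ?ler0n// ltW.
have D_gt0 x : 0 <= x -> 0 < 1 + b * x.
  by move=> x_ge0; rewrite ltr_wpDr ?ltr01 ?(mulr_ge0 b_ge0).
apply: (@le_trans _ _ (c * (S / (1 + b * S)))).
  rewrite /c [leRHS](_ : _ =
      (P * beta1 * b * (N%:R * S)) / (sigma2 * (1 + b * S))); last first.
    by field; rewrite !gt_eqF ?D_gt0.
  rewrite ler_pM2r ?invr_gt0 ?mulr_gt0 ?D_gt0//.
  rewrite -(mulrA (P * beta1) beta2) -/b ler_wpM2l ?sqr_normc_gain_le//.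
  by rewrite !mulr_ge0 // ltW.
(* The claimed maximum is the same expression at [S = N%:R * alpha ^+ 2]: one factor of [N%:R ^+ 2]
   sits in [c], the other in this value of [S]. *)
rewrite [leRHS](_ : _ =
  c * (N%:R * alpha ^+ 2 / (1 + b * (N%:R * alpha ^+ 2)))).
  by rewrite ler_wpM2l// ler_div1D.
have := D_gt0 _ (le_trans S_ge0 S_le); rewrite /c /b => /lt0r_neq0 D_neq0.
(* This gives both denominators the shape covered by [D_neq0]. *)
rewrite [alpha ^+ 2 * beta2 * _ * _](_ : _ =
  beta2 * M%:R * (N%:R * alpha ^+ 2)); last by ring.
by field; rewrite D_neq0 gt_eqF.
Qed.
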